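(* Let $\alpha>1$ be fixed and $f_i=1/i^\alpha$ for $i\in[n]$. Let $n,B,k\in\mathbb{N}$ with $k\ge2$ and $B\le n/k$. Let $h_1,\dots,h_k:[n]\to[B]$ be independent, truly (uniformly) random hash functions, and for $i\in[n]$ define $\tilde f_i=\min_{\ell\in[k]}\big(\sum_{j\in[n]}[h_\ell(j)=h_\ell(i)]f_j\big)$. Then there is a constant $C$ depending only on $\alpha$ such that for every $i\in[n]$, $$\mathbb{E}[|\tilde f_i-f_i|]\le C^k(\log B)^{k/\alpha+1}\left(\frac1{B^k}+\frac1{B^\alpha}\right),$$ and furthermore $\mathbb{E}[|\tilde f_i-f_i|]=\Omega\!\left(\frac1{B^k}+\frac1{(B\log k)^\alpha}\right)$.
   Context: $[E]$ is the indicator of event $E$. This is Count-Min on generalized Zipfian frequencies with exponent $\alpha$.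
   Formalization: The upper bound is stated for B ≥ 2: at B = 1 its right side is 0 because log 1 = 0, while the error is the positive sum of f_j over j ≠ i, so it fails there; the lower bound is stated for all B ≥ 1. *)

(* Defs.v *)
From HB Require Import structures.
From mathcomp Require Export all_boot all_order all_algebra.
From mathcomp Require Export all_classical all_reals all_analysis.
Set Implicit Arguments.
Unset Strict Implicit.
Unset Printing Implicit Defensive.
Import Order.TTheory GRing.Theory Num.Theory.
Local Open Scope classical_set_scope.
Local Open Scope ring_scope.

(* The index set [n] = {1, ..., n} is represented by 'I_n = {0, ..., n - 1}:
   the ordinal i stands for the item i.+1. *)
Definition zipf_freq (R : realType) (alpha : R) (n : nat) (i : 'I_n) : R :=
  (i.+1%:R `^ alpha)^-1.

Section random_functions.
Context (R : realType) (d : measure_display) (T : measurableType d).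
Variable P : probability T R.

Definition uniform_on (U : finType) (X : T -> U) : Prop :=
  forall u : U, measurable (X @^-1` [set u]) /\
                P (X @^-1` [set u]) = (#|U|%:R^-1)%:E.

(* Every subset of the finite type U is measurable (discrete sigma-algebra),
   hence the product rule over arbitrary sets A l. *)
Definition mutually_independent (I U : finType) (X : I -> T -> U) : Prop :=
  forall (J : {set I}) (A : I -> set U),
    P (\bigcap_(l in [set` J]) (X l @^-1` A l)) =
    (\prod_(l in J) P (X l @^-1` A l))%E.

Definition independent_truly_random_hashes (n B k : nat)
    (h : 'I_k -> T -> {ffun 'I_n -> 'I_B}) : Prop :=
  (forall l : 'I_k, uniform_on (h l)) /\ mutually_independent h.

End random_functions.

(* The infimum ranges over a finite set, nonempty as soon as 0 < k: it is the
   minimum over the k hash functions. *)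
Definition count_min (R : realType) (n B k : nat) (f : 'I_n -> R)
    (h : 'I_k -> {ffun 'I_n -> 'I_B}) (i : 'I_n) : R :=
  inf (range (fun l : 'I_k => \sum_(j < n) (h l j == h l i)%:R * f j)).

(* Main.v *)
(** Writing [X_l] for the mass of the other items colliding with [i] under
    [h_l], the error is [min_l X_l], so by independence
    [P(error >= t) = p(t)^k] with [p(t) = P(X_1 >= t)].

    Upper bound: [X_1 >= t] forces the colliding frequencies truncated at [t]
    to sum to at least [t], and Markov's inequality gives [p(t) <= D t^(-1/alpha) / B].
    Summing [t p(t)^k] over the [O(log B)] dyadic levels
    [B^-alpha <= t <= alpha / (alpha - 1)] yields the claim, even without the
    factor [(log B)^(k / alpha)]; since [B >= 2], inserting it costs at most
    [(log 2)^(-k / alpha)], which [C^k] absorbs.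

    Lower bound: [t p(t)^k <= E[error]] for every [t]. Taking [t = 2^-alpha]
    gives the term [B^-k], since one of the two most frequent items differs
    from [i]. Taking [t = (m + 1)^-alpha] with [m] just above [B log k] gives
    [p(t) >= 1 - (1 - 1/B)^m >= 1 - 1/k], and [(1 - 1/k)^k >= e^-2]. *)

Require Import Defs.
From mathcomp Require Import measurable_realfun ring lra zify.
Set Implicit Arguments.
Unset Strict Implicit.
Unset Printing Implicit Defensive.
Import Order.TTheory GRing.Theory Num.Theory.
Local Open Scope classical_set_scope.
Local Open Scope ring_scope.

(** * Tail probabilities of the error *)

Section uniform.
Context (R : realType) (d : measure_display) (T : measurableType d).
Variables (P : probability T R) (U : finType) (X : T -> U).
Hypothesis uX : uniform_on P X.

Lemma preimage_finset (S : {set U}) :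
  X @^-1` [set` S] = \bigcup_(u in [set` S]) X @^-1` [set u].
Proof.
apply/seteqP; split=> [w Sw|w [u Su /= ->]//].
by exists (X w).
Qed.

Lemma measurable_preimage_finset (S : {set U}) :
  measurable (X @^-1` [set` S]).
Proof.
rewrite preimage_finset; apply: fin_bigcup_measurable => //.
by move=> u _; have [] := uX u.
Qed.

Lemma prob_preimage_finset (S : {set U}) :
  P (X @^-1` [set` S]) = (#|S|%:R / #|U|%:R)%:E.
Proof.
rewrite preimage_finset measure_fin_bigcup//; last 2 first.
  by move=> u v _ _ [w [/= <- <-]].
  by move=> u _; have [] := uX u.
have -> : [set` S] = [set` enum S] by apply/seteqP; split=> u /=; rewrite mem_enum.
rewrite -fsbig_seq ?enum_uniq//.
rewrite (eq_bigr (fun=> (#|U|%:R^-1)%:E)); last first.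
  by move=> u _; exact: (uX u).2.
rewrite sumEFin big_const_seq count_predT -cardE; congr EFin.
by rewrite iter_addr_0 mulr_natl.
Qed.

End uniform.

Section excess.
Context (R : realType) (n B : nat).
Implicit Types (f : 'I_n -> R) (i : 'I_n) (g : {ffun 'I_n -> 'I_B}).

Definition excess f i g : R := \sum_(j < n | j != i) (g j == g i)%:R * f j.

Definition tail f i (t : R) : {set {ffun 'I_n -> 'I_B}} :=
  [set g | t <= excess f i g]%SET.

(** The law of one row as a proportion of hash functions: under [uniform_on] it equals
    [P(X_1 >= t)], so the estimates on it become finite counting, free of [P]. *)
Definition tail_prob f i (t : R) : R :=
  #|tail f i t|%:R / #|{ffun 'I_n -> 'I_B}|%:R.

Lemma tail_prob_ge0 f i t : 0 <= tail_prob f i t.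
Proof. by rewrite divr_ge0. Qed.

Lemma excess_ge0 f i g : (forall j, 0 <= f j) -> 0 <= excess f i g.
Proof. by move=> f0; apply: sumr_ge0 => j _; rewrite mulr_ge0. Qed.

Lemma excess_le_sum f i g : (forall j, 0 <= f j) ->
  excess f i g <= \sum_(j < n) f j.
Proof.
move=> f0; rewrite /excess big_mkcond; apply: ler_sum => j _.
by case: ifP => // _; case: (g j == g i); rewrite ?mul1r ?mul0r.
Qed.

(** The term [j = i] of every row sum is exactly [f i], and a minimum reaches a level iff every row
    does. [0 < k] matters because [inf] of the empty set is a default value. *)
Lemma count_min_sub_ge (k : nat) f (h : 'I_k -> {ffun 'I_n -> 'I_B}) i t :
    (0 < k)%N ->
  (t <= count_min f h i - f i) = [forall l, h l \in tail f i t].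
Proof.
move=> k0; pose F l := \sum_(j < n) (h l j == h l i)%:R * f j.
have FE l : F l = excess f i (h l) + f i.
  by rewrite /F (bigD1 i)//= eqxx mul1r addrC.
have lbF : has_lbound (range F).
  exists (\big[Order.min/0]_l F l) => _ [l _ <-]; exact: bigmin_le.
rewrite lerBrDr; apply/idP/forallP => [tF l|tF].
  rewrite inE -(lerD2r (f i)) -FE; apply: le_trans tF _.
  by apply: ge_inf => //; exists l.
apply: lb_le_inf; first by exists (F (Ordinal k0)), (Ordinal k0).
move=> _ [l _ <-]; rewrite -/(F l) FE lerD2r.
by have := tF l; rewrite inE.
Qed.

End excess.

Arguments tail {R n B} f i t.

Section error.
Context (R : realType) (d : measure_display) (T : measurableType d).
Variables (P : probability T R) (n B k : nat) (f : 'I_n -> R) (i : 'I_n).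
Variable h : 'I_k -> T -> {ffun 'I_n -> 'I_B}.
Hypotheses (k0 : (0 < k)%N) (f0 : forall j, 0 <= f j).
Hypothesis hP : independent_truly_random_hashes P h.

Let Y (w : T) : R := `|count_min f (fun l => h l w) i - f i|.

Let Y_ge t w : (t <= Y w) = [forall l, h l w \in tail f i t].
Proof.
(* The absolute value is removed by the same equivalence at [t = 0], a level that every excess
   reaches. *)
rewrite /Y ger0_norm ?count_min_sub_ge//.
by apply/forallP => l; rewrite inE excess_ge0.
Qed.

Lemma error_ge_preimage t : [set w | t <= Y w] =
  \bigcap_(l in [set` [set: 'I_k]%SET]) (h l @^-1` [set` tail f i t]).
Proof.
apply/seteqP; split=> w /=; rewrite Y_ge.
  by move/forallP => H l _; exact: H.
by move=> H; apply/forallP => l; apply: H => /=; rewrite inE.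
Qed.

Lemma indic_error_ge t w : \1_[set w | t <= Y w] w = (t <= Y w)%R%:R :> R.
Proof. by rewrite indicE; congr (nat_of_bool _)%:R; apply/idP/idP; rewrite inE. Qed.

Lemma measurable_error_ge t : measurable [set w | t <= Y w].
Proof.
rewrite error_ge_preimage; apply: fin_bigcap_measurable => // l _.
exact/measurable_preimage_finset/(hP.1 l).
Qed.

Lemma prob_error_ge t : P [set w | t <= Y w] = (tail_prob B f i t ^+ k)%:E.
Proof.
rewrite error_ge_preimage hP.2.
under eq_bigr do rewrite (prob_preimage_finset (hP.1 _)).
rewrite prodEFin; congr EFin.
by rewrite prodr_const cardsT card_ord.
Qed.

Lemma measurable_error : measurable_fun [set: T] Y.
Proof.
move=> mT; apply: (measurability _ (RGenCInfty.measurableE R)) => //.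
move=> _ [_ [t ->] <-]; rewrite setTI.
rewrite (_ : _ @^-1` _ = [set w | t <= Y w]); first exact: measurable_error_ge.
by apply/seteqP; split=> w /=; rewrite in_itv/= andbT.
Qed.

Lemma error_le_sum w : Y w <= \sum_(j < n) f j.
Proof.
(* At the level [t = Y w] the equivalence says that the error is at most the excess of any single
   row. *)
have := Y_ge (Y w) w; rewrite lexx => /esym/forallP/(_ (Ordinal k0)).
by rewrite inE => /le_trans; apply; exact: excess_le_sum.
Qed.

(** Markov's inequality: [t] times the indicator of [t <= Y] is at most [Y]. *)
Lemma expectation_error_ge t : 0 <= t ->
  ((t * tail_prob B f i t ^+ k)%:E <= 'E_P[Y])%E.
Proof.
move=> t0; rewrite EFinM -prob_error_ge.
have mA := measurable_error_ge t.
rewrite -[X in P X]setIT -integral_indic// -ge0_integralZl_EFin//; last first.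
  exact/measurable_EFinP/measurable_indic.
rewrite unlock; apply: ge0_le_integral => //.
- by move=> w _; rewrite -EFinM lee_fin mulr_ge0.
- exact/measurable_EFinP/measurable_funM/measurable_indic.
- exact/measurable_EFinP/measurable_error.
move=> w _; rewrite -EFinM lee_fin indic_error_ge.
by case: (leP t (Y w)) => [tY|_]; rewrite ?mulr1 ?mulr0 ?normr_ge0.
Qed.

Lemma expectation_error_le (N : nat) (c t : 'I_N -> R) :
    (forall s, 0 <= c s) ->
    (forall w, Y w <= \sum_(s < N) c s * (t s <= Y w)%R%:R) ->
  ('E_P[Y] <= (\sum_(s < N) c s * tail_prob B f i (t s) ^+ k)%:E)%E.
Proof.
move=> c0 YE; rewrite -sumEFin.
under eq_bigr => s _ do rewrite EFinM -prob_error_ge.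
pose F s w := (c s * \1_[set w | t s <= Y w] w)%:E : \bar R.
have mF s : measurable_fun setT (F s).
  apply/measurable_EFinP/measurable_funM => //.
  exact/measurable_indic/measurable_error_ge.
have F0 s w : (0 <= F s w)%E by rewrite lee_fin mulr_ge0.
apply: (@le_trans _ _ (\int[P]_w \sum_(s < N) F s w)%E).
  rewrite unlock; apply: ge0_le_integral => //.
  - by move=> w _; rewrite lee_fin normr_ge0.
  - exact/measurable_EFinP/measurable_error.
  - exact: emeasurable_fun_sum.
  - move=> w _; rewrite sumEFin lee_fin; apply: le_trans (YE w) _.
    by apply: ler_sum => s _; rewrite indic_error_ge.
rewrite ge0_integral_sum//; apply: lee_sum => s _.
have mA := measurable_error_ge (t s).
rewrite -[X in P X]setIT -integral_indic// -ge0_integralZl_EFin//.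
exact/measurable_EFinP/measurable_indic.
Qed.

End error.

(** * Collisions under a uniform hash function *)

Section collisions.
Context (R : realType) (n B : nat).
Hypothesis B0 : (0 < B)%N.
Implicit Types (f : 'I_n -> R) (i j : 'I_n) (S : {set 'I_n}).

Let card_hash_neq0 : #|{ffun 'I_n -> 'I_B}|%:R != 0 :> R.
Proof. by rewrite pnatr_eq0 card_ffun !card_ord -lt0n expn_gt0 B0. Qed.

Let B_neq0 : B%:R != 0 :> R.
Proof. by rewrite pnatr_eq0 -lt0n. Qed.

(** Once the value of [g i] is fixed, the other values are free, and each item of [S] keeps [B - 1]
    choices out of [B]. *)
Lemma no_collision_prob i S : i \notin S ->
  #|[set g : {ffun 'I_n -> 'I_B} | [forall j in S, g j != g i]]%SET|%:R
    / #|{ffun 'I_n -> 'I_B}|%:R = (1 - B%:R^-1) ^+ #|S| :> R.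
Proof.
move=> iS.
(* [F v j] is the set of values allowed to [g j] when [g i = v]; for each [v] the functions counted
   then form a product family. *)
pose F (v : 'I_B) (j : 'I_n) : pred 'I_B :=
  if j == i then pred1 v else if j \in S then predC1 v else predT.
have -> : #|[set g : {ffun 'I_n -> 'I_B} | [forall j in S, g j != g i]]%SET|
    = (\sum_(v < B) \prod_(j < n) #|F v j|)%N.
  rewrite -sum1_card (partition_big (fun g : {ffun 'I_n -> 'I_B} => g i) xpredT)//=.
  apply: eq_bigr => v _; rewrite sum1dep_card.
  transitivity #|family (F v)|; last by rewrite card_family foldrE big_image.
  apply: eq_card => g; rewrite !inE; apply/andP/familyP.
    move=> [/forall_inP gS /eqP gi] j; rewrite /F.
    have [->|ji] := eqVneq j i; first by rewrite inE gi.
    case: ifP => [jS|]//; by rewrite !inE -gi; exact: gS.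
  move=> gF; have gi : g i = v by have := gF i; rewrite /F eqxx inE => /eqP.
  split; last by rewrite gi.
  apply/forall_inP => j jS; have := gF j; rewrite /F jS gi.
  by case: eqVneq => [ji|_]; [rewrite -ji jS in iS|rewrite !inE].
rewrite card_ffun !card_ord natr_sum mulr_suml.
have E (v : 'I_B) : (\prod_(j < n) #|F v j|)%N%:R / (B ^ n)%N%:R
    = B%:R^-1 * (1 - B%:R^-1) ^+ #|S| :> R.
  have -> : (B ^ n)%:R = \prod_(j < n) B%:R :> R.
    by rewrite prodr_const card_ord natrX.
  rewrite natr_prod -prodf_div.
  rewrite (bigD1 i)//= {1}/F eqxx card1 mul1r; congr (_ * _).
  rewrite (bigID (mem S))/= [X in _ * X]big1 ?mulr1; last first.
    move=> j /andP[ji jS]; rewrite /F (negbTE ji) (negbTE jS).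
    by rewrite card_ord divff.
  rewrite (eq_bigl (mem S)); last first.
    by move=> j /=; case: eqVneq => //= ->; rewrite (negbTE iS).
  rewrite (eq_bigr (fun=> 1 - B%:R^-1)) ?prodr_const// => j jS.
  have ji : j != i by apply: contraNneq iS => <-.
  rewrite /F (negbTE ji) (jS : j \in S) cardC1 card_ord -subn1 natrB//.
  by rewrite mulrBl divff// mul1r.
rewrite (eq_bigr _ (fun v _ => E v)) sumr_const card_ord -[LHS]mulr_natl.
by rewrite mulrA divff// mul1r.
Qed.

Lemma collision_prob i j : j != i ->
  #|[set g : {ffun 'I_n -> 'I_B} | g j == g i]%SET|%:R
    / #|{ffun 'I_n -> 'I_B}|%:R = B%:R^-1 :> R.
Proof.
move=> ji; have := @no_collision_prob i [set j]%SET.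
rewrite inE eq_sym ji cards1 expr1 => /(_ isT).
set A := [set g : {ffun 'I_n -> 'I_B} | g j == g i]%SET.
rewrite (_ : #|_| = #|~: A|); last first.
  apply: eq_card => g; rewrite !inE; apply/forall_inP/idP.
    by apply; rewrite inE.
  by move=> gij l; rewrite inE => /eqP ->.
move=> E; apply: (@addrI _ (1 - B%:R^-1)); rewrite -{1}E -mulrDl -natrD.
by rewrite addnC cardsC divff// subrK.
Qed.

(** A collision with a single item of [S] already lifts the excess to [t], so missing the tail means
    avoiding all of [S]. *)
Lemma tail_prob_ge f i t S : (forall j, 0 <= f j) -> i \notin S ->
    (forall j, j \in S -> t <= f j) ->
  1 - (1 - B%:R^-1) ^+ #|S| <= tail_prob B f i t.
Proof.
move=> f0 iS tS; rewrite -(no_collision_prob iS).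
set A := [set g | _]%SET.
rewrite /tail_prob lerBlDr -mulrDl -natrD ler_pdivlMr ?mul1r; last first.
  by rewrite lt0r card_hash_neq0 ler0n.
rewrite ler_nat -(cardsC A) addnC leq_add2r; apply/subset_leq_card/fintype.subsetP => g.
rewrite !inE negb_forall => /existsP[j]; rewrite negb_imply negbK.
move=> /andP[jS /eqP gji]; have ji : j != i by apply: contraNneq iS => <-.
rewrite /excess (bigD1 j)//= gji eqxx mul1r; apply: le_trans (tS _ jS) _.
by rewrite lerDl; apply: sumr_ge0 => l _; rewrite mulr_ge0.
Qed.

(* Markov's inequality after truncating the frequencies at height [t]. *)
Lemma tail_prob_le f i t : (forall j, 0 <= f j) -> 0 < t ->
  tail_prob B f i t <= B%:R^-1 * \sum_(j < n) Num.min 1 (f j / t).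
Proof.
move=> f0 t0; pose m j := Num.min 1 (f j / t).
have m0 j : 0 <= m j by rewrite le_min ler01 divr_ge0// ltW.
apply: (@le_trans _ _ (\sum_(j < n | j != i) B%:R^-1 * m j)); last first.
  rewrite -mulr_sumr ler_wpM2l// [leRHS](bigID (fun j => j != i))/= lerDl.
  by apply: sumr_ge0 => j _; exact: m0.
(* By linearity, since each [j != i] collides with [i] with probability [1 / B]. *)
have -> : \sum_(j < n | j != i) B%:R^-1 * m j =
   (\sum_(g : {ffun 'I_n -> 'I_B}) \sum_(j < n | j != i) (g j == g i)%:R * m j)
     / #|{ffun 'I_n -> 'I_B}|%:R.
  rewrite exchange_big mulr_suml/=; apply: eq_bigr => j ji.
  rewrite -mulr_suml mulrAC -(collision_prob ji); congr (_ / _ * _).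
  by rewrite -sum1_card natr_sum big_mkcond/=; apply: eq_bigr => g _; rewrite inE; case: ifP.
rewrite ler_wpM2r// -sum1_card natr_sum big_mkcond/=; apply: ler_sum => g _.
have nn (Q : pred 'I_n) : 0 <= \sum_(j < n | Q j) (g j == g i)%:R * m j.
  by apply: sumr_ge0 => j _; rewrite mulr_ge0.
rewrite inE; case: ifP => // tg.
(* Either one colliding item alone reaches [t] and has truncated weight 1, or all colliding items
   are light and truncation does not alter their sum. *)
have [/existsP[j /and3P[ji gji tj]]|] :=
    boolP [exists j, [&& j != i, g j == g i & t <= f j]].
  rewrite (bigD1 j)//= gji mul1r {1}/m min_l ?lerDl ?ler_pdivlMr ?mul1r//.
rewrite negb_exists => /forallP light.
rewrite (eq_bigr (fun j => (g j == g i)%:R * f j / t)) => [|j ji].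
  by rewrite -mulr_suml ler_pdivlMr// mul1r.
have := light j; rewrite ji/=; case: eqP => //= _; rewrite ?mul0r//.
by rewrite -ltNge => fjt; rewrite /m min_r ?mul1r// ler_pdivrMr// mul1r ltW.
Qed.

End collisions.

(** * Zipfian sums *)

Section zipf.
Context (R : realType) (alpha : R).
Hypothesis alpha_gt1 : 1 < alpha.

Let alpha1 : 0 < alpha - 1. Proof. by rewrite subr_gt0. Qed.
Let alpha0 : 0 < alpha. Proof. exact: lt_trans alpha_gt1. Qed.

(* The discrete form of [\int_q^(q+1) x^-alpha dx >= (q+1)^-alpha]. *)
Lemma powRN_telescope (q : nat) : (0 < q)%N ->
  (q.+1%:R `^ alpha)^-1 <=
  (q%:R `^ (1 - alpha) - q.+1%:R `^ (1 - alpha)) / (alpha - 1).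
Proof.
move=> q0; have qR : 0 < q%:R :> R by rewrite ltr0n.
have q1R : 0 < q.+1%:R :> R by rewrite ltr0n.
rewrite ler_pdivlMr//.
have E1 : (q.+1%:R `^ alpha)^-1 = q.+1%:R `^ (1 - alpha) / q.+1%:R.
  rewrite -[q.+1%:R^-1]powR_inv1 ?ltW// -powRD ?lt0r_neq0 ?implybT// -powRN.
  by congr (_ `^ _); ring.
set x : R := q.+1%:R^-1.
have E2 : q%:R `^ (1 - alpha) = q.+1%:R `^ (1 - alpha) * (1 - x) `^ (1 - alpha).
  have x1 : 1 - x = q%:R / q.+1%:R.
    by rewrite /x -[q%:R](addrK 1) natr1 mulrBl divff ?lt0r_neq0// mul1r.
  rewrite -powRM ?x1 ?divr_ge0//; congr (_ `^ _).
  by rewrite mulrCA divff ?mulr1 ?lt0r_neq0.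
have x0 : 0 < x by rewrite invr_gt0.
have x1 : x < 1 by rewrite invf_lt1 // ltr1n ltnS.
(* Bernoulli's inequality for the negative exponent [1 - alpha], from [1 + y <= expR y] and
   [ln (1 - x) <= - x]. *)
have E3 : 1 + (alpha - 1) * x <= (1 - x) `^ (1 - alpha).
  rewrite /powR; case: ifPn => [|_]; first by rewrite subr_eq0 gt_eqF.
  apply: le_trans (expR_ge1Dx _) _; rewrite ler_expR.
  have l : ln (1 - x) <= - x by apply: le_ln1Dx; rewrite ltrN2.
  by rewrite -[leRHS]opprK -mulNr -mulrN opprB ler_pM2l// lerNr.
rewrite E1 E2 -/x.
rewrite -[X in _ <= _ - X]mulr1 -mulrBr -mulrA ler_wpM2l ?powR_ge0//.
by rewrite lerBrDl mulrC.
Qed.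

Lemma zipf_tail_sum (m N : nat) : (0 < m)%N -> (m <= N)%N ->
  \sum_(m <= j < N) (j.+1%:R `^ alpha)^-1 <= m%:R `^ (1 - alpha) / (alpha - 1).
Proof.
move=> m0 mN.
apply: (@le_trans _ _ (\sum_(m <= j < N)
    (j%:R `^ (1 - alpha) - j.+1%:R `^ (1 - alpha)) / (alpha - 1))).
  rewrite big_nat_cond [leRHS]big_nat_cond; apply: ler_sum => j /andP[/andP[mj _] _].
  exact/powRN_telescope/(leq_trans m0).
rewrite -mulr_suml.
rewrite (telescope_sumr_eq (fun j : nat => - j%:R `^ (1 - alpha)))//.
  by rewrite opprK ler_wpM2r ?invr_ge0 ?(ltW alpha1)// gerDr oppr_le0 powR_ge0.
by move=> j _; rewrite opprK addrC.
Qed.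

Lemma zipf_sum_le (n : nat) :
  \sum_(j < n) zipf_freq alpha j <= alpha / (alpha - 1).
Proof.
rewrite /zipf_freq -(big_mkord xpredT (fun j => (j.+1%:R `^ alpha)^-1)).
case: n => [|n]; first by rewrite big_geq// divr_ge0 ?ltW.
rewrite big_ltn// powR1 invr1.
have -> : alpha / (alpha - 1) = 1 + 1%:R `^ (1 - alpha) / (alpha - 1).
  by rewrite powR1; field; rewrite gt_eqF.
by rewrite lerD2l zipf_tail_sum.
Qed.

(** The constant [D] of the overview: 1 pays for the frequent items, the second summand for the
    tail, where [2 ^ (alpha - 1)] comes from rounding a rank down. *)
Definition zipf_const : R := 1 + 2 `^ (alpha - 1) / (alpha - 1).

(** [u = t ^ (-1 / alpha)] is the rank at which the frequency falls to [t]: the items before it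
    contribute at most 1 each, and the tail after it is again of order [u]. *)
Lemma zipf_trunc_sum_le (n : nat) (t : R) : 0 < t ->
  \sum_(j < n) Num.min 1 (zipf_freq alpha j / t) <= zipf_const * t `^ (- alpha^-1).
Proof.
move=> t0; set u := t `^ (- alpha^-1).
have u0 : 0 < u by rewrite powR_gt0.
have ua : t^-1 = u `^ alpha.
  by rewrite -powRrM mulNr mulVf ?gt_eqF// powR_inv1// ltW.
have ti0 : 0 <= t^-1 by rewrite invr_ge0 ltW.
have two1 : 1 <= 2 `^ (alpha - 1) :> R.
  by have := @ler_powR R 2 _ _ _ (ltW alpha1); rewrite powRr0; apply; rewrite ler1n.
pose z (j : nat) : R := (j.+1%:R `^ alpha)^-1.
have z0 j : 0 <= z j by rewrite invr_ge0 powR_ge0.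
(* If [u < 1], all frequencies lie below [t]; the full sum serves, with [u ^ alpha <= u]. *)
have [u1|u1] := ltP u 1.
  apply: (@le_trans _ _ (\sum_(j < n) zipf_freq alpha j / t)).
    by apply: ler_sum => j _; rewrite ge_min lexx orbT.
  rewrite -mulr_suml ua.
  apply: (@le_trans _ _ (alpha / (alpha - 1) * u)).
    apply: ler_pM; rewrite ?powR_ge0 ?zipf_sum_le//.
      by apply: sumr_ge0 => j _; exact: z0.
    by apply: ge1r_powR; rewrite ?u0 ltW.
  rewrite ler_wpM2r ?(ltW u0)// /zipf_const.
  have -> : alpha / (alpha - 1) = 1 + 1 / (alpha - 1) by field; rewrite gt_eqF.
  by rewrite lerD2l ler_wpM2r// invr_ge0 ltW.
pose m := Num.trunc u.
have [mu um] : m%:R <= u /\ u < m.+1%:R by apply/andP/truncn_itv/ltW.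
have m0 : (0 < m)%N by rewrite truncn_gt0.
have mR : 0 < m%:R :> R by rewrite ltr0n.
(* The tail bound carries [m] to the negative power [1 - alpha], so [m] must be bounded from
   below. *)
have u2m : u / 2 <= m%:R.
  rewrite ler_pdivrMr// (le_trans (ltW um))// -natrM ler_nat; lia.
(* The range grows to [maxn m n] by nonnegative terms, so that it can be cut at [m] even when
   [n < m]. *)
rewrite (big_ord_widen (maxn m n) (fun j => Num.min 1 (z j / t))) ?leq_maxr//.
rewrite big_mkcond/=.
apply: (@le_trans _ _ (\sum_(j < maxn m n) Num.min 1 (z j / t))).
  apply: ler_sum => j _; case: ifP => // _.
  by rewrite le_min ler01 mulr_ge0.
rewrite -(big_mkord xpredT (fun j => Num.min 1 (z j / t))).
rewrite (big_cat_nat (n := m)) ?leq_maxl//= /zipf_const mulrDl mul1r.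
apply: lerD.
  apply: (le_trans _ mu).
  apply: (@le_trans _ _ (\sum_(0 <= j < m) 1)).
    by apply: ler_sum => j _; rewrite ge_min lexx.
  by rewrite sumr_const_nat subn0.
apply: (@le_trans _ _ (\sum_(m <= j < maxn m n) z j / t)).
  by apply: ler_sum => j _; rewrite ge_min lexx orbT.
rewrite -mulr_suml ua.
apply: (@le_trans _ _ (m%:R `^ (1 - alpha) / (alpha - 1) * u `^ alpha)).
  by rewrite ler_wpM2r ?powR_ge0// zipf_tail_sum// leq_maxl.
rewrite mulrAC [leRHS]mulrAC ler_wpM2r ?invr_ge0 ?(ltW alpha1)//.
have -> : 2 `^ (alpha - 1) * u = (u / 2) `^ (1 - alpha) * u `^ alpha.
  rewrite powRM ?ltW// -[2^-1]powR_inv1// -powRrM mulN1r opprB mulrAC mulrC.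
  congr (_ * _); rewrite -powRD ?gt_eqF ?implybT// addrNK ?powRr1 ?ltW//.
rewrite ler_wpM2r ?powR_ge0// -opprB !powRN lef_pV2 ?posrE ?powR_gt0 ?divr_gt0//.
by apply: ge0_ler_powR; rewrite ?nnegrE ?(ltW alpha1) ?divr_ge0 ?(ltW u0).
Qed.

End zipf.

(** * The upper bound *)

Lemma tail_prob_le1 (R : realType) (n B : nat) (f : 'I_n -> R) i t :
  tail_prob B f i t <= 1.
Proof.
rewrite /tail_prob; have [->|U0] := posnP #|{ffun 'I_n -> 'I_B}|.
  by rewrite invr0 mulr0.
by rewrite ler_pdivrMr ?ltr0n// mul1r ler_nat max_card.
Qed.

Lemma expectation_error_le_cst (R : realType) (d : measure_display)
    (T : measurableType d) (P : probability T R) (n B k : nat) (f : 'I_n -> R)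
    (i : 'I_n) (h : 'I_k -> T -> {ffun 'I_n -> 'I_B}) (N : nat)
    (b : R) (t : 'I_N -> R) :
    let Y w := `|count_min f (fun l => h l w) i - f i| in
    (0 < k)%N -> (forall j, 0 <= f j) -> independent_truly_random_hashes P h ->
    0 <= b -> (forall s, 0 <= t s) ->
    (forall w, Y w <= b + \sum_(s < N) t s * (t s <= Y w)%R%:R) ->
  ('E_P[Y] <= (b + \sum_(s < N) t s * tail_prob B f i (t s) ^+ k)%:E)%E.
Proof.
move=> Y k0 f0 hP b0 t0 Yle.
(* The constant [b] becomes an extra level, of weight [b] and threshold 0, whose event is
   certain. *)
pose c' (s : 'I_N.+1) := oapp t b (unlift ord0 s).
pose t' (s : 'I_N.+1) := oapp t 0 (unlift ord0 s).
apply: (le_trans (@expectation_error_le _ _ _ P n B k f i h k0 f0 hP N.+1 c' t' _ _)).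
- by move=> s; rewrite /c'; case: (unlift ord0 s) => [j|]/=.
- move=> w; rewrite big_ord_recl /c' /t' unlift_none/= normr_ge0 mulr1.
  under eq_bigr do rewrite liftK/=.
  exact: Yle.
- rewrite big_ord_recl /c' /t' unlift_none/= lee_fin.
  under eq_bigr do rewrite liftK/=.
  by rewrite lerD2r ler_piMr// exprn_ile1 ?tail_prob_ge0 ?tail_prob_le1.
Qed.

Lemma dyadic_layer_cake (R : realType) (Y a : R) (N : nat) :
    0 <= a -> Y < 2 ^+ N * a ->
  Y <= a + \sum_(s < N) 2 ^+ s * a * (2 ^+ s * a <= Y)%R%:R.
Proof.
(* Capping [Y] makes the induction independent of [YN]: doubling the cap from [e] raises the left
   side by at most [e], and only if [e <= Y]. *)
move=> a0 YN; suff : Num.min Y (2 ^+ N * a) <=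
    a + \sum_(s < N) 2 ^+ s * a * (2 ^+ s * a <= Y)%R%:R.
  by rewrite min_l// ltW.
elim: N {YN} => [|N IH]; first by rewrite big_ord0 expr0 mul1r addr0 ge_min lexx orbT.
rewrite big_ord_recr/= addrA.
have e0 : 0 <= 2 ^+ N * a by rewrite mulr_ge0// exprn_ge0.
set e := 2 ^+ N * a in IH e0 *.
have -> : 2 ^+ N.+1 * a = e + e by rewrite exprS /e; ring.
case: (leP e Y) IH => eY IH; last first.
  by rewrite mulr0 addr0; apply: le_trans IH; rewrite ge_min lexx.
by rewrite mulr1; apply: (@le_trans _ _ (e + e)); rewrite ?ge_min ?lexx ?orbT// lerD2r.
Qed.

(** A power is monotone, so one endpoint dominates; adding both spares a case split on the sign of
    [e], later the sign of [1 - k / alpha]. *)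
Lemma powR_le_endpoints (R : realType) (a x b e : R) :
  0 < a -> a <= x -> x <= b -> 1 <= b -> e <= 1 -> x `^ e <= b + a `^ e.
Proof.
move=> a0 ax xb b1 e1.
have x0 : 0 < x := lt_le_trans a0 ax.
have b0 : 0 < b := lt_le_trans x0 xb.
have [e0|e0] := leP 0 e.
  apply: (@le_trans _ _ b); last by rewrite lerDl powR_ge0.
  apply: le_trans (ler1_powR b1 e1).
  by apply: ge0_ler_powR; rewrite ?nnegrE ?(ltW x0) ?(ltW b0).
apply: (@le_trans _ _ (a `^ e)); last by rewrite lerDr ltW.
rewrite -(opprK e) !(powRN _ (- e)) lef_pV2 ?posrE ?powR_gt0//.
by apply: ge0_ler_powR; rewrite ?nnegrE ?oppr_ge0 ?(ltW e0) ?(ltW a0) ?(ltW x0).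
Qed.

Lemma ln2_le1 (R : realType) : ln 2 <= 1 :> R.
Proof. by have := @le_ln1Dx R 1; apply; lra. Qed.

Lemma ln2_gt0 (R : realType) : 0 < ln 2 :> R.
Proof. by rewrite ln_gt0// ltr1n. Qed.

Lemma ln_nat_ge_ln2 (R : realType) (m : nat) : (2 <= m)%N -> ln 2 <= ln m%:R :> R.
Proof. by move=> m2; rewrite ler_ln ?posrE ?ltr0n ?ler_nat// (leq_trans _ m2). Qed.

Lemma zipf_freq_ge0 (R : realType) (alpha : R) (n : nat) (j : 'I_n) :
  0 <= zipf_freq alpha j.
Proof. by rewrite invr_ge0 powR_ge0. Qed.

Section upper.
Context (R : realType) (alpha : R).
Hypothesis alpha_gt1 : 1 < alpha.

Let alpha1 : 0 < alpha - 1. Proof. by rewrite subr_gt0. Qed.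
Let alpha0 : 0 < alpha. Proof. exact: lt_trans alpha_gt1. Qed.

Let M : R := alpha / (alpha - 1).
Let D : R := zipf_const alpha.

Let M1 : 1 <= M.
Proof. by rewrite /M ler_pdivlMr// mul1r gerBl. Qed.

Let D1 : 1 <= D.
Proof. by rewrite lerDl divr_ge0 ?powR_ge0// ltW. Qed.

(** The Markov bound makes the term at most [D ^ k * B ^ -k * t ^ (1 - k / alpha)]. The endpoint
    [t = M] yields [B ^ -k], and [t = B ^ -alpha] yields [B ^ -alpha]. *)
Lemma tail_term_le (n B k : nat) (i : 'I_n) (t : R) : (0 < B)%N ->
    (B%:R `^ alpha)^-1 <= t -> t <= M ->
  t * tail_prob B (@zipf_freq R alpha n) i t ^+ k <=
  D ^+ k * M * ((B%:R ^+ k)^-1 + (B%:R `^ alpha)^-1).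
Proof.
move=> B0; set a := (B%:R `^ alpha)^-1 => at_ tM.
have BR : 0 < B%:R :> R by rewrite ltr0n.
have a0 : 0 < a by rewrite invr_gt0 powR_gt0.
have t0 : 0 < t := lt_le_trans a0 at_.
pose v := t `^ (- alpha^-1).
apply: (@le_trans _ _ (t * (B%:R^-1 * (D * v)) ^+ k)).
  rewrite ler_pM2l// lerXn2r ?nnegrE ?tail_prob_ge0//.
    by rewrite !mulr_ge0 ?invr_ge0 ?powR_ge0// (le_trans ler01).
  apply: (le_trans (tail_prob_le B0 i (@zipf_freq_ge0 R alpha n) t0)).
  by rewrite ler_pM2l ?invr_gt0// zipf_trunc_sum_le.
have -> : t * (B%:R^-1 * (D * v)) ^+ k =
    D ^+ k * (B%:R ^+ k)^-1 * t `^ (1 - k%:R / alpha).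
  have -> : t `^ (1 - k%:R / alpha) = t * v ^+ k.
    rewrite powRD ?(gt_eqF t0) ?implybT// powRr1 ?(ltW t0)//; congr (_ * _).
    by rewrite /v -powR_mulrn ?powR_ge0// -powRrM; congr (_ `^ _); ring.
  by rewrite !exprMn exprVn; ring.
have e1 : 1 - k%:R / alpha <= 1 by rewrite gerBl divr_ge0// ltW.
have le := powR_le_endpoints a0 at_ tM M1 e1.
have ae : a `^ (1 - k%:R / alpha) = B%:R ^+ k * a.
  rewrite powRD ?(gt_eqF a0) ?implybT// powRr1 ?(ltW a0)// mulrC; congr (_ * _).
  rewrite /a -powRN -powRrM -powR_mulrn ?(ltW BR)//; congr (_ `^ _).
  by field; rewrite gt_eqF.
have Dk : 0 <= D ^+ k by rewrite exprn_ge0// (le_trans ler01).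
apply: le_trans (_ : D ^+ k * (B%:R ^+ k)^-1 * (M + B%:R ^+ k * a) <= _).
  by rewrite -ae ler_wpM2l// mulr_ge0// invr_ge0 exprn_ge0.
rewrite -[leLHS]mulrA -[leRHS]mulrA ler_wpM2l// [leLHS]mulrDr.
rewrite mulKf ?expf_neq0 ?gt_eqF// [leRHS]mulrDr [X in X + _ <= _]mulrC lerD2l.
by rewrite ler_peMl// ltW.
Qed.

(** [K * ln B] bounds the number of dyadic levels: [log_2 (M * B ^ alpha)], plus 1 for rounding,
    each compared with [ln B] through [ln 2 <= ln B]. *)
Let K : R := (ln M / ln 2 + alpha) / ln 2 + (ln 2)^-1.
(** The first summand pays for the base level of the layer cake, the second for the [N] dyadic
    terms. *)
Let Q : R := (ln 2)^-1 + K * M.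

Let K0 : 0 <= K.
Proof.
have l2 := ltW (ln2_gt0 R); rewrite addr_ge0 ?invr_ge0//.
by rewrite divr_ge0// addr_ge0 ?(ltW alpha0)// divr_ge0// ln_ge0.
Qed.

Let Q1 : 1 <= Q.
Proof.
apply: (@le_trans _ _ (ln 2)^-1); first by rewrite invf_ge1 ?ln2_gt0// ln2_le1.
by rewrite lerDl mulr_ge0// (le_trans ler01 M1).
Qed.

Lemma zipf_error_le (n B k : nat) (d : measure_display) (T : measurableType d)
    (P : probability T R) (h : 'I_k -> T -> {ffun 'I_n -> 'I_B}) (i : 'I_n) :
    (0 < k)%N -> (2 <= B)%N -> independent_truly_random_hashes P h ->
  ('E_P[(fun w => `|count_min (@zipf_freq R alpha n) (fun l => h l w) i
                      - zipf_freq alpha i|)%R]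
   <= (Q * D ^+ k * ln B%:R * ((B%:R ^+ k)^-1 + (B%:R `^ alpha)^-1))%:E)%E.
Proof.
move=> k0 B2 hP; have B0 : (0 < B)%N := ltnW B2.
have BR : 0 < B%:R :> R by rewrite ltr0n.
have l20 := ln2_gt0 R; have lB := ln_nat_ge_ln2 R B2.
set a := (B%:R `^ alpha)^-1.
have a0 : 0 < a by rewrite invr_gt0 powR_gt0.
have a1 : a <= 1.
  rewrite invf_le1 ?powR_gt0//.
  by have := @ler_powR R B%:R _ _ _ (ltW alpha0); rewrite powRr0; apply; rewrite ler1n.
have Ma1 : 1 <= M / a by rewrite ler_pdivlMr// mul1r (le_trans a1).
have Ma0 : 0 < M / a := lt_le_trans ltr01 Ma1.
pose y := ln (M / a) / ln 2.
have y0 : 0 <= y by apply: divr_ge0; [exact: ln_ge0|exact: ltW].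
(* With this [N] the top value [2 ^ N * a] exceeds [M], hence every error, while all levels [s < N]
   stay at most [M]. *)
pose N := (Num.trunc y).+1.
have [Ny yN] : (Num.trunc y)%:R <= y /\ y < N%:R by apply/andP/truncn_itv.
have expln (s : nat) : s%:R * ln 2 = ln (2 ^+ s) :> R.
  by rewrite lnXn// mulr_natl.
have MN : M < 2 ^+ N * a.
  rewrite -ltr_pdivrMr// -ltr_ln ?posrE ?exprn_gt0// -expln.
  by rewrite -ltr_pdivrMr.
have sM (s : 'I_N) : 2 ^+ s * a <= M.
  rewrite -ler_pdivlMr// -ler_ln ?posrE ?exprn_gt0// -expln -ler_pdivlMr//.
  by apply: le_trans Ny; rewrite ler_nat -ltnS.
have NK : N%:R <= K * ln B%:R.
  have -> : N%:R = (Num.trunc y)%:R + 1 :> R by rewrite natr1.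
  apply: (@le_trans _ _ (y + 1)); first by rewrite lerD2r.
  rewrite /y ln_div ?posrE// ?(lt_le_trans ltr01 M1)// lnV ?posrE ?powR_gt0//.
  rewrite ln_powR opprK /K [leRHS]mulrDl; apply: lerD; last first.
    by rewrite mulrC ler_pdivlMr ?mul1r.
  rewrite mulrAC ler_pM2r ?invr_gt0// mulrDl lerD2r -mulrA ler_peMr ?ln_ge0//.
  by rewrite mulrC ler_pdivlMr ?mul1r.
pose Z := (B%:R ^+ k)^-1 + a.
have Za : a <= Z by rewrite lerDr invr_ge0 exprn_ge0.
have Z0 : 0 < Z := lt_le_trans a0 Za.
have Dk : 1 <= D ^+ k by rewrite exprn_ege1.
have s0 (s : 'I_N) : 0 <= 2 ^+ s * a by rewrite mulr_ge0 ?exprn_ge0// ltW.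
apply: le_trans
  (@expectation_error_le_cst R d T P n B k _ i h N a (fun s => 2 ^+ s * a)
    k0 (@zipf_freq_ge0 R alpha n) hP (ltW a0) s0 _) _.
  move=> w; apply: dyadic_layer_cake; first exact: ltW.
  apply: le_lt_trans MN; apply: le_trans (zipf_sum_le alpha_gt1 n).
  exact: (error_le_sum i h k0 (@zipf_freq_ge0 R alpha n)).
rewrite lee_fin.
apply: (@le_trans _ _ (a + \sum_(s < N) D ^+ k * M * Z)).
  rewrite lerD2l; apply: ler_sum => s _; apply: tail_term_le => //.
  by rewrite -/a ler_peMl ?(ltW a0)// exprn_ege1// ler1n.
rewrite sumr_const card_ord -[X in _ + X <= _]mulr_natl /Q.
rewrite mulrDl mulrDl mulrDl; apply: lerD.
  apply: (le_trans Za); rewrite -/Z -[leLHS]mul1r ler_pM2r// mulrAC.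
  by rewrite -[1]mulr1 ler_pM// mulrC ler_pdivlMr ?mul1r.
rewrite mulrA ler_pM2r//.
have -> : K * M * D ^+ k * ln B%:R = K * ln B%:R * (D ^+ k * M) by ring.
by rewrite ler_wpM2r// mulr_ge0 ?(le_trans ler01 M1) ?(le_trans ler01 Dk).
Qed.

Lemma zipf_upper_const : exists2 C : R, 0 < C &
  forall (B k : nat), (0 < k)%N -> (2 <= B)%N ->
    Q * D ^+ k * ln B%:R <= C ^+ k * (ln B%:R) `^ (k%:R / alpha + 1).
Proof.
have l20 := ln2_gt0 R.
(* [r ^ k = (ln 2) ^ (k / alpha)] is at most [(ln B) ^ (k / alpha)]; dividing by [r] in the constant
   absorbs the inserted logarithm. *)
pose r := (ln 2 : R) `^ alpha^-1.
have r0 : 0 < r by rewrite powR_gt0.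
have QD0 : 0 < Q * D by rewrite mulr_gt0// (lt_le_trans ltr01).
exists (Q * D / r); first by rewrite divr_gt0.
move=> B k k0 B2; have lB := ln_nat_ge_ln2 R B2.
have lB0 : 0 < ln B%:R :> R := lt_le_trans l20 lB.
rewrite powRD ?(gt_eqF lB0) ?implybT// powRr1 ?(ltW lB0)// mulrA ler_pM2r//.
rewrite expr_div_n -mulrA exprMn.
apply: (@le_trans _ _ (Q ^+ k * D ^+ k)).
  by rewrite ler_pM2r ?exprn_gt0 ?(lt_le_trans ltr01 D1)// ler_eXnr.
rewrite ler_peMr ?mulr_ge0 ?exprn_ge0 ?(le_trans ler01 Q1) ?(le_trans ler01 D1)//.
rewrite mulrC ler_pdivlMr ?exprn_gt0// mul1r -powR_mulrn ?(ltW r0)// -powRrM mulrC.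
apply: ge0_ler_powR; rewrite ?nnegrE ?(ltW l20) ?(ltW lB0)//.
by rewrite divr_ge0// ltW.
Qed.

End upper.

(** * The lower bound *)

Section lower.
Context (R : realType) (alpha : R).
Hypothesis alpha_gt1 : 1 < alpha.

Let alpha0 : 0 < alpha. Proof. exact: lt_trans alpha_gt1. Qed.

(** [1 - 1 / k] is the inverse of [1 + 1 / (k - 1)], hence at least [expR (- 1 / (k - 1))], and
    [k / (k - 1) <= 2]. *)
Lemma expR2_le_subVX (k : nat) : (2 <= k)%N ->
  expR (- 2) <= (1 - k%:R^-1) ^+ k :> R.
Proof.
move=> k2; have kR : 2 <= k%:R :> R by rewrite ler_nat.
have k1 : 0 < k%:R - 1 :> R by lra.
have k0 : 0 < k%:R :> R by lra.
have e : expR (- (k%:R - 1)^-1) <= 1 - k%:R^-1 :> R.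
  have -> : 1 - k%:R^-1 = (1 + (k%:R - 1)^-1)^-1 :> R.
    by field; rewrite subrK !gt_eqF.
  by rewrite expRN lef_pV2 ?posrE ?expR_gt0 ?expR_ge1Dx// addr_gt0 ?invr_gt0.
apply: le_trans (lerXn2r k _ _ e); rewrite ?nnegrE ?expR_ge0//; last first.
  by rewrite subr_ge0 invf_le1//; lra.
rewrite -expRM_natl ler_expR mulrN lerN2 ler_pdivrMr//; lra.
Qed.

Lemma zipf_freq_ge (n : nat) (j : 'I_n) (m : nat) : (j < m)%N ->
  (m%:R `^ alpha)^-1 <= zipf_freq alpha j.
Proof.
move=> jm; have m0 : (0 < m)%N by apply: leq_trans jm.
rewrite lef_pV2 ?posrE ?powR_gt0 ?ltr0n//.
by apply: ge0_ler_powR; rewrite ?nnegrE ?(ltW alpha0)// ler_nat.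
Qed.

(* The [m] most frequent items other than [i] all have frequency at least
   [(m + 1)^-alpha]. *)
Lemma zipf_tail_prob_ge (n B : nat) (i : 'I_n) (m : nat) :
    (0 < B)%N -> (m < n)%N ->
  1 - (1 - B%:R^-1) ^+ m <=
  tail_prob B (@zipf_freq R alpha n) i (m.+1%:R `^ alpha)^-1.
Proof.
move=> B0 mn.
(* [m + 1] items are taken so that at least [m] remain after removing [i], wherever [i] lies. *)
pose A : {set 'I_n} := (widen_ord mn @: [set: 'I_m.+1])%SET.
have cA : #|A| = m.+1.
  by rewrite card_imset ?cardsT ?card_ord// => x y /(congr1 val)/= /val_inj.
have := @tail_prob_ge R n B B0 (@zipf_freq R alpha n) i
  (m.+1%:R `^ alpha)^-1 (A :\ i)%SET (@zipf_freq_ge0 R alpha n).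
rewrite !inE eqxx => /(_ isT) H; apply: le_trans (H _).
  rewrite lerB// ler_wiXn2l//.
  - by rewrite subr_ge0 invf_le1 ?ltr0n// ler1n.
  - by rewrite -ltnS -cA (cardsD1 i A) -add1n leq_add2r leq_b1.
move=> j; rewrite !inE => /andP[_ /imsetP[x _ ->]].
by apply: zipf_freq_ge; exact: (ltn_ord x).
Qed.

(** Chosen so that [m + 1 <= B * ln k + 2 <= L * (B * ln k)], using [ln 2 <= B * ln k]. Also
    [2 <= L], which covers the level [2 ^ -alpha]. *)
Let L : R := 1 + 2 / ln 2.
Let c : R := expR (- 2) / (L `^ alpha) / 2.

Lemma zipf_error_ge (n B k : nat) (d : measure_display) (T : measurableType d)
    (P : probability T R) (h : 'I_k -> T -> {ffun 'I_n -> 'I_B}) (i : 'I_n) :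
    (2 <= k)%N -> (1 <= B)%N -> (k * B <= n)%N ->
    independent_truly_random_hashes P h ->
  ((c * ((B%:R ^+ k)^-1 + ((B%:R * ln k%:R) `^ alpha)^-1))%:E
   <= 'E_P[(fun w => `|count_min (@zipf_freq R alpha n) (fun l => h l w) i
                       - zipf_freq alpha i|)%R])%E.
Proof.
move=> k2 B0 kBn hP; have k0 : (0 < k)%N := ltnW k2.
have BR : 1 <= B%:R :> R by rewrite ler1n.
have BR0 : 0 < B%:R :> R := lt_le_trans ltr01 BR.
have kR0 : 0 < k%:R :> R by rewrite ltr0n.
have l20 := ln2_gt0 R; have l21 := ln2_le1 R; have lk := ln_nat_ge_ln2 R k2.
have lk0 : 0 < ln k%:R :> R := lt_le_trans l20 lk.
have L2 : 2 <= L.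
  by rewrite -[2]add0r lerD// ler_pdivlMr//; nra.
have L0 : 0 < L by lra.
have La : 0 < L `^ alpha by rewrite powR_gt0.
have e2 : expR (- 2) <= 1 :> R by rewrite expR_le1; lra.
set E := 'E_P[_]%E; set x := (B%:R ^+ k)^-1.
set b := ((B%:R * ln k%:R) `^ alpha)^-1.
have lb t : 0 <= t -> ((t * tail_prob B (@zipf_freq R alpha n) i t ^+ k)%:E <= E)%E.
  exact: (expectation_error_ge i k0 (@zipf_freq_ge0 R alpha n) hP).
have E1 : ((2 * c * x)%:E <= E)%E.
  apply: le_trans (lb (2%:R `^ alpha)^-1 _); last by rewrite invr_ge0 powR_ge0.
  have := @zipf_tail_prob_ge n B i 1 B0 (leq_trans (leq_mul k2 B0) kBn).
  rewrite expr1 subKr => tp; rewrite lee_fin.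
  have -> : 2 * c = expR (- 2) / L `^ alpha by rewrite /c; field; rewrite gt_eqF.
  apply: ler_pM.
  - by rewrite divr_ge0 ?expR_ge0 ?powR_ge0.
  - by rewrite invr_ge0 exprn_ge0.
  - rewrite -[leRHS]mul1r ler_pM ?expR_ge0 ?invr_ge0 ?powR_ge0//.
    rewrite lef_pV2 ?posrE ?powR_gt0//.
    by apply: ge0_ler_powR; rewrite ?nnegrE ?(ltW alpha0) ?(ltW L0).
  - by rewrite /x -exprVn lerXn2r ?nnegrE ?invr_ge0 ?tail_prob_ge0.
have Bl0 : 0 <= B%:R * ln k%:R :> R by rewrite mulr_ge0 ?ltW.
pose m := (Num.trunc (B%:R * ln k%:R : R)).+1.
have [m1 m2] : m%:R <= B%:R * ln k%:R + 1 :> R /\ B%:R * ln k%:R < m%:R :> R.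
  have /andP[t1 t2] := truncn_itv Bl0.
  by split=> //; rewrite -natr1 lerD2r.
(* Here [B <= n / k] enters: [ln k < k - 1] gives [m <= (k - 1) * B < k * B <= n]. *)
have mn : (m < n)%N.
  have : (m <= (k - 1) * B)%N.
    rewrite truncn_lt_nat// natrM mulrC ltr_pM2r// natrB// ltrBrDl.
    by rewrite -[ltRHS](@lnK R) ?posrE// expR_gt1Dx// gt_eqF.
  rewrite mulnBl mul1n => /leq_ltn_trans mk; apply: leq_trans kBn; apply: mk.
  by rewrite ltn_subrL B0 muln_gt0 k0.
have tp : (1 - k%:R^-1) <= tail_prob B (@zipf_freq R alpha n) i (m.+1%:R `^ alpha)^-1.
  apply: le_trans (zipf_tail_prob_ge i B0 mn).
  (* [(1 - 1 / B) ^ m <= expR (- m / B) <= 1 / k], because [m] exceeds [B * ln k]. *)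
  rewrite lerB//; apply: (@le_trans _ _ (expR (- B%:R^-1) ^+ m)).
    rewrite lerXn2r ?nnegrE ?expR_ge0 ?expR_ge1Dx//.
    by rewrite subr_ge0 invf_le1.
  rewrite -expRM_natl -[leRHS](@lnK R) ?posrE ?invr_gt0// ler_expR.
  by rewrite lnV ?posrE// mulrN lerN2 ler_pdivlMr// mulrC ltW.
have E2 : ((2 * c * b)%:E <= E)%E.
  apply: le_trans (lb (m.+1%:R `^ alpha)^-1 _); last by rewrite invr_ge0 powR_ge0.
  rewrite lee_fin.
  have -> : 2 * c * b = (L `^ alpha * (B%:R * ln k%:R) `^ alpha)^-1 * expR (- 2).
    rewrite /c /b invfM; field.
    by rewrite !gt_eqF ?powR_gt0// mulr_gt0.
  rewrite -powRM ?(ltW L0)//.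
  apply: ler_pM; rewrite ?invr_ge0 ?powR_ge0 ?expR_ge0//.
    rewrite lef_pV2 ?posrE ?powR_gt0 ?ltr0n ?mulr_gt0//.
    apply: ge0_ler_powR; rewrite ?nnegrE ?(ltW alpha0) ?mulr_ge0 ?(ltW L0) ?(ltW lk0)//.
    rewrite -natr1; apply: (@le_trans _ _ (B%:R * ln k%:R + 2)); first by lra.
    rewrite /L mulrDl mul1r lerD2l mulrAC ler_pdivlMr// ler_pM2l//.
    by rewrite -[leLHS]mul1r ler_pM// ltW.
  apply: le_trans (expR2_le_subVX k2) _.
  by rewrite lerXn2r ?nnegrE ?tail_prob_ge0// subr_ge0 invf_le1// ler1n.
have c0 : 0 <= c by rewrite !divr_ge0 ?expR_ge0 ?powR_ge0.
have scale y : x + b <= 2 * y -> c * (x + b) <= 2 * c * y.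
  by move=> xby; rewrite -[leRHS]mulrA [leRHS]mulrCA ler_wpM2l.
(* The larger of [x] and [b] is at least half their sum, whence the factor 1/2 in [c]. *)
have [xb|bx] := leP x b.
  by apply: le_trans E2; rewrite lee_fin scale//; lra.
by apply: le_trans E1; rewrite lee_fin scale//; lra.
Qed.

Lemma zipf_lower_const_gt0 : 0 < c.
Proof.
have L0 : 0 < L by rewrite addr_gt0// divr_gt0// ln2_gt0.
by rewrite !divr_gt0 ?expR_gt0 ?powR_gt0.
Qed.

End lower.

Theorem theoremA2 (R : realType) (alpha : R) (halpha : 1 < alpha) :
  (exists C : R, 0 < C /\
     forall (n B k : nat), (2 <= k)%N -> (2 <= B)%N ->
       B%:R <= n%:R / k%:R :> R ->
     forall (d : measure_display) (T : measurableType d) (P : probability T R)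
       (h : 'I_k -> T -> {ffun 'I_n -> 'I_B}),
       independent_truly_random_hashes P h ->
     forall i : 'I_n,
       ('E_P[(fun w => `|count_min (@zipf_freq R alpha n) (fun l => h l w) i
                        - zipf_freq alpha i|)%R]
        <= (C ^+ k * (ln B%:R) `^ (k%:R / alpha + 1)
            * ((B%:R ^+ k)^-1 + (B%:R `^ alpha)^-1))%:E)%E) /\
  (exists c : R, 0 < c /\
     forall (n B k : nat), (2 <= k)%N -> (1 <= B)%N ->
       B%:R <= n%:R / k%:R :> R ->
     forall (d : measure_display) (T : measurableType d) (P : probability T R)
       (h : 'I_k -> T -> {ffun 'I_n -> 'I_B}),
       independent_truly_random_hashes P h ->
     forall i : 'I_n,
       ((c * ((B%:R ^+ k)^-1 + ((B%:R * ln k%:R) `^ alpha)^-1))%:E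
        <= 'E_P[(fun w => `|count_min (@zipf_freq R alpha n) (fun l => h l w) i
                           - zipf_freq alpha i|)%R])%E).
Proof.
have hyp (n B k : nat) : (2 <= k)%N -> B%:R <= n%:R / k%:R :> R -> (k * B <= n)%N.
  by move=> k2; rewrite ler_pdivlMr ?ltr0n ?(ltnW k2)// -natrM ler_nat mulnC.
split.
  have [C C0 HC] := zipf_upper_const halpha.
  exists C; split=> // n B k k2 B2 _ d T P h hP i.
  apply: (le_trans (zipf_error_le halpha i (ltnW k2) B2 hP)).
  rewrite lee_fin; apply: ler_wpM2r; last exact: HC (ltnW k2) B2.
  by rewrite addr_ge0 ?invr_ge0 ?exprn_ge0 ?powR_ge0.
eexists; split; first exact: (zipf_lower_const_gt0 alpha).
move=> n B k k2 B1 /(hyp _ _ _ k2) kBn d T P h hP i.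
exact: zipf_error_ge.
Qed.
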